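(* Let $X$ be a Čech-complete topological group, $K$ a compact group and $G$ an infinite subset of $CHom(X,K)$. If for every countable subset $L\subseteq G$ and every compact separable subset $Y\subseteq X$ we have that either $\overline{L}^{K^Y}$ has countable tightness or $|\overline{L}^{K^Y}|\le\mathfrak{c}$, then $G$ is equicontinuous.
   Context: All topological spaces $X$, $K$ are assumed to be infinite, completely regular and Hausdorff. A space is Čech-complete if it is a $G_\delta$-subset of its Stone-Čech compactification. $CHom(X,K)$ is the set of all continuous homomorphisms of $X$ into $K$. For $L\subseteq CHom(X,K)$ and $Y\subseteq X$, $\overline{L}^{K^Y}$ is the closure of the set of restrictions $L|_Y=\{g|_Y:g\in L\}$ in $K^Y$ with the product (pointwise convergence) topology. A space $Z$ has countable tightness if whenever $z\in\overline{A}$, $A\subseteq Z$, there is a countable $B\subseteq A$ with $z\in\overline{B}$. $\mathfrak{c}$ is the cardinality of the continuum. Equicontinuity is with respect to the unique compatible uniformity of the compact group $K$. *)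

(* Defs.v *)
From HB Require Import structures.
From mathcomp Require Import all_boot all_order all_algebra.
From mathcomp Require Import all_classical all_reals all_analysis.
From mathcomp Require Import borel_hierarchy.
Import numFieldNormedType.Exports.

Set Implicit Arguments.
Unset Strict Implicit.
Unset Printing Implicit Defensive.

Local Open Scope classical_set_scope.
Local Open Scope ring_scope.

HB.mixin Record isTopologicalGroup G & Topological G & Group G := {
  mulg_continuous : continuous (fun x : G * G => (x.1 * x.2)%g);
  invg_continuous : continuous (fun x : G => (x^-1)%g)
}.

#[short(type="topologicalGroupType")]
HB.structure Definition TopologicalGroup :=
  {G of Topological G & Group G & isTopologicalGroup G}.

(* A topological group equipped with a uniformity inducing its topology; it is
   not required to be one of the translation uniformities of the group. On a
   compact Hausdorff group exactly one uniformity is compatible, so there this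
   carries no more information than a topological group. Pointedness is only
   what [equicontinuous] asks of its codomain; the point need not be 1. *)
#[short(type="puniformGroupType")]
HB.structure Definition PointedUniformGroup :=
  {G of PointedUniform G & TopologicalGroup G}.

Section StoneCech.
Context (R : realType) (X : topologicalType).

Definition unit_maps : set (X -> R) :=
  [set f : X -> R | continuous f /\ range f `<=` `[0, 1]].

Definition cube_eval (x : X) : {ptws unit_maps -> R} := fun f => set_val f x.

(* The closure is taken in R^C(X,[0,1]); this is the closure in the cube
   [0,1]^C(X,[0,1]), which is a closed subset. *)
Definition stone_cech : topologicalType := set_type (closure (range cube_eval)).

Definition stone_cech_unit (x : X) : stone_cech :=
  exist _ (cube_eval x) (mem_set (subset_closure (imageT cube_eval x))).

Definition cech_complete : Prop := Gdelta (range stone_cech_unit).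

End StoneCech.

Arguments stone_cech R X : clear implicits.
Arguments cech_complete R X : clear implicits.

Definition CHom (X K : topologicalGroupType) : set (X -> K) :=
  [set f | continuous f /\ {morph f : x y / (x * y)%g}].
Arguments CHom X K : clear implicits.

Definition separable_space (T : topologicalType) : Prop :=
  exists2 D : set T, countable D & dense D.

Definition countably_tight (T : topologicalType) : Prop :=
  forall (A : set T) (z : T), closure A z ->
    exists B : set T, [/\ B `<=` A, countable B & closure B z].

Definition ptws_closure (X : Type) (K : topologicalType) (Y : set X)
    (L : set (X -> K)) : set {ptws Y -> K} :=
  closure ([set sigL Y g | g in L] : set {ptws Y -> K}).
Arguments ptws_closure {X K} Y L.

(* Main.v *)
(* Suppose [G] is not equicontinuous. As it consists of homomorphisms, some
   neighbourhood [U] of 1 in [K] is left, on every neighbourhood of 1 in [X], by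
   a member of [G]. This gives points [x n] tending quickly to 1 and maps [f n]
   in [G] with [f n (x n)] outside [U] and [f k (x n)] very small for [k < n];
   by Cech-completeness the [x n] can be chosen so small that all finite ordered
   products of the [x n] and their inverses lie in one compact set. Along an
   ultrafilter, [f n (x k)] tends to some [c k], and pairs [k < l] with [c k]
   close to [c l] yield points [z i = (x k)^-1 * x l] and maps [g i = f k] with
   [g i (z i)] far from 1 and [g j (z i)] small for all [j != i]. For
   [r : nat -> bool], let [y r] be a cluster point of the products of the [z i]
   with [r i] true: then [g n (y r)] is far from 1 if [r n], and close to 1
   otherwise. Hence the pointwise closure of the [g n] on the closure of these
   products maps onto the cube [2 ^ R], through an independent family of subsets
   of [nat] indexed by the reals. So this closure is larger than the continuum,
   and it is not countably tight since the points of countable support are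
   dense in the cube but no countable set of them accumulates at the constant
   point 1. *)

Require Import Defs.
From HB Require Import structures.
From mathcomp Require Import all_boot all_order all_algebra.
From mathcomp Require Import all_classical all_reals all_analysis.
Import Order.TTheory GRing.Theory Num.Theory numFieldNormedType.Exports.
Local Open Scope classical_set_scope.
Local Open Scope card_scope.
Local Open Scope group_scope.

Set Implicit Arguments.
Unset Strict Implicit.
Unset Printing Implicit Defensive.

(** * Neighbourhoods of 1 in a topological group *)

Lemma cvgMg (G : topologicalGroupType) (I : Type) (F : set_system I)
    (FF : Filter F) (f g : I -> G) (a b : G) :
  f @ F --> a -> g @ F --> b -> (fun i => f i * g i) @ F --> a * b.
Proof.
move=> fa gb; apply: (cvg_comp2 (h := fun x y : G => x * y) fa gb).
exact: (@mulg_continuous G (a, b)).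
Qed.

Lemma cvgVg (G : topologicalGroupType) (I : Type) (F : set_system I)
    (FF : Filter F) (f : I -> G) (a : G) :
  f @ F --> a -> (fun i => (f i)^-1) @ F --> a^-1.
Proof. by move=> fa; apply: cvg_comp fa _; exact: invg_continuous. Qed.

Lemma nbhs1_sym_split (G : topologicalGroupType) (U : set G) :
  nbhs 1 U -> exists W : set G,
    [/\ open W, W 1, forall x, W x -> W x^-1 &
        forall x y, W x -> W y -> U (x * y)].
Proof.
move=> U1; have := @mulg_continuous G (1, 1) U; rewrite /= mulg1.
move=> /(_ U1) [[A B] /= [A1 B1] ABU].
pose C := (A `&` B)°.
have oC : open C by exact: open_interior.
have C1 : nbhs 1 C by apply: nbhs_interior; exact: filterI.
exists (C `&` (fun x => x^-1) @^-1` C); split.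
- apply: openI => //; apply: open_comp => // x _; exact: invg_continuous.
- by split; rewrite /= ?invg1; exact: nbhs_singleton.
- by move=> x [Cx Cx1]; split => //=; rewrite invgK.
- move=> x y [/interior_subset[Ax _] _] [/interior_subset[_ By] _].
  exact: (ABU (x, y)).
Qed.

(** This chain stands in for a metric: products of arbitrarily many factors, taken from later and
    later [W i], stay in a fixed [W m]. *)
Lemma nbhs1_sym_chain (G : topologicalGroupType) (U : set G) :
  nbhs 1 U -> exists W : nat -> set G,
    [/\ W 0 `<=` U, forall i, open (W i), forall i, W i 1,
        forall i x, W i x -> W i x^-1 &
        forall i x y, W i.+1 x -> W i.+1 y -> W i (x * y)].
Proof.
move=> U1; pose good (W : set G) := [/\ open W, W 1 & forall x, W x -> W x^-1].
have step (V : {W : set G | good W}) : {V' : {W : set G | good W} |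
    forall x y, sval V' x -> sval V' y -> sval V (x * y)}.
  apply: cid; case: V => V [oV V1 VV] /=.
  have [W [oW W1 WV WW]] := nbhs1_sym_split (open_nbhs_nbhs (conj oV V1)).
  have gW : good W by [].
  by exists (exist _ W gW).
have [W0 [oW0 W01 W0V W0W]] := nbhs1_sym_split U1.
have gW0 : good W0 by [].
have [f [f0 fS]] := dependent_choice step (exist _ W0 gW0).
exists (fun i => sval (f i)); split=> [|i|i|i x|i x y].
- by rewrite f0 /= => x W0x; rewrite -[x]mulg1; exact: W0W.
- by have [] := svalP (f i).
- by have [] := svalP (f i).
- by have [_ _] := svalP (f i); exact.
- exact: fS.
Qed.

(** If [g] is in the closure of [W], then [g * W] meets [W], so [g] is an element of [W] times the
    inverse of another. *)
Lemma closure_sub_mul (G : topologicalGroupType) (W V : set G) :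
  open W -> W 1 -> (forall x, W x -> W x^-1) ->
  (forall x y, W x -> W y -> V (x * y)) -> closure W `<=` V.
Proof.
move=> oW W1 WV WW g /(_ [set u | W (g^-1 * u)]) [].
  have : (fun u => g^-1 * u) @ g --> 1.
    by rewrite -(mulVg g); apply: cvgMg; [exact: cvg_cst|exact: cvg_id].
  by apply; exact: open_nbhs_nbhs.
move=> u [Wu /= /WV]; rewrite invgM invgK => Wu'.
by rewrite -[g](mulVKg u); exact: WW.
Qed.

(** * Pointwise convergence, subspaces and ultrafilters *)

Lemma ptws_cvgP (U : Type) (V : topologicalType) (F : set_system {ptws U -> V})
    (FF : Filter F) (f : {ptws U -> V}) :
  F --> f <-> forall u, (fun g : {ptws U -> V} => g u) @ F --> f u.
Proof.
split=> [Ff u A fuA|Fpt].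
  apply: ((@cvg_sup _ _ _ F f FF).1 Ff u).
  exact: initial_continuous.
apply/cvg_sup => u A [_ [[B oB <-] Bfu] BA].
have : F ((fun g : {ptws U -> V} => g u) @^-1` B).
  by apply: Fpt; exact: open_nbhs_nbhs.
exact: filterS.
Qed.

Lemma ptws_eval_continuous (U : Type) (V : topologicalType) (u : U) :
  continuous (fun g : {ptws U -> V} => g u).
Proof.
move=> f; have [+ _] := ptws_cvgP (nbhs_filter f) f.
by apply; exact: cvg_id.
Qed.

Lemma nbhs_set_typeP (T : topologicalType) (A : set T) (a : A) (U : set A) :
  nbhs a U <-> exists2 V, nbhs (set_val a) V & set_val @^-1` V `<=` U.
Proof.
split=> [[_ [[V oV <-] Va] VU]|[V Va VU]].
  by exists V => //; exact: open_nbhs_nbhs.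
by apply: filterS VU _; exact: initial_continuous.
Qed.

Lemma ultra_cvg_compact (I : Type) (T : topologicalType) (F : set_system I)
    (UF : UltraFilter F) (f : I -> T) (A : set T) :
  compact A -> F (f @^-1` A) -> exists a, A a /\ f @ F --> a.
Proof.
move=> cA FA; have [a [Aa cla]] := cA (f @ F) _ FA.
exists a; split=> // B aB.
have [//|FB] := in_ultra_setVsetC (f @^-1` B) UF.
by have [y []] := cla (~` B) B FB aB.
Qed.

(** * Compact sets in a Čech-complete space *)

Lemma cube_eval_continuous (R : realType) (X : topologicalType) :
  continuous (@cube_eval R X).
Proof.
move=> x; apply/ptws_cvgP => f.
by have [cf _] := set_valP f; exact: cf.
Qed.

(** A function separating [x] from the complement of [W] is itself a coordinate of the cube, so
    convergence of that coordinate brings the filter into [W]. *)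
Lemma cube_eval_cvg (R : realType) (X : topologicalType) (F : set_system X)
    (FF : ProperFilter F) (x : X) : completely_regular_space X ->
  @cube_eval R X @ F --> @cube_eval R X x -> F --> x.
Proof.
move=> crX Fx A; rewrite nbhsE => -[W [oW Wx] WA].
have /(@uniform_separatorP _ R)[f [cf rf f0 f1]] :
  uniform_separator [set x] (~` W).
  by apply: crX; [exact: open_closedC|exact].
have uf : unit_maps (X:=X) f by [].
have evalF := (@ptws_cvgP (@unit_maps R X) R (@cube_eval R X @ F)
  (fmap_filter _ FF) (@cube_eval R X x)).1 Fx.
have {evalF}/= := evalF (SigSub (mem_set uf)) [set r | (r < 1)%R].
rewrite /cube_eval /= => fF.
have fx0 : f x = 0%R by apply: f0; exists x.
have oI : open [set r : R | (r < 1)%R] by exact: open_lt.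
have FW : F [set y | (f y < 1)%R].
  apply: fF; apply: open_nbhs_nbhs; split=> //=.
  by rewrite set_valE /= fx0 ltr01.
apply: filterS WA _; apply: filterS FW => y /=.
apply: contraPP => Wy.
by rewrite (f1 (f y)) ?ltxx //; exists y.
Qed.

(** [V n] holds of a set whose image in the cube has its closure inside the open set [W n] that
    traces the [n]-th set of the G-delta. Regularity of the cube gives such neighbourhoods of
    points, hence of finite sets. For a set small at every [n], the closure of its image stays in
    the image of [X], so limits taken in the cube come back to [X]. *)
Lemma cech_complete_small (R : realType) (X : topologicalType) :
  completely_regular_space X -> cech_complete R X ->
  exists V : nat -> set (set X),
    (forall n (Q : seq X) (O : set X), open O -> {subset Q <= O} ->
      exists T, [/\ open T, {subset Q <= T}, T `<=` O & V n T]) /\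
    (forall D : set X, (forall n, exists2 T, D `<=` T & V n T) ->
      compact (closure D)).
Proof.
move=> crX [F oF rangeE].
have /choice[W oW] (n : nat) : exists W : set {ptws @unit_maps R X -> R},
    open W /\ set_val @^-1` W = F n by have [W ? ?] := oF n; exists W.
have We x n : W n (@cube_eval R X x).
  suff: F n (stone_cech_unit R x) by rewrite -(oW n).2.
  have : range (@stone_cech_unit R X) (stone_cech_unit R x) by exists x.
  by rewrite rangeE; apply.
have eW b : closure (range (@cube_eval R X)) b -> (forall n, W n b) ->
    range (@cube_eval R X) b.
  move=> clb Wb; pose b' : stone_cech R X := SigSub (mem_set clb).
  have : range (@stone_cech_unit R X) b'.
    rewrite rangeE => n _; rewrite -(oW n).2; exact: Wb.
  by move=> [x _ xb]; exists x => //; have := congr1 set_val xb.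
pose V n A := closure (@cube_eval R X @` A) `<=` W n.
exists V; split=> [n Q O oO|D VD].
  elim: Q => [|q Q IH] QO.
    exists set0; split=> //; [exact: open0|].
    by rewrite /V image_set0 closure0.
  have [|T [oT QT TO VT]] := IH.
    by move=> y Qy; apply: QO; rewrite inE Qy orbT.
  have [N qN NW] := uniform_regular (open_nbhs_nbhs (conj (oW n).1 (We q n))).
  pose U := ((@cube_eval R X @^-1` N)° `&` O).
  have Uq : U q.
    split; last by apply/set_mem/QO; rewrite mem_head.
    exact: cube_eval_continuous.
  exists (T `|` U); split.
  - by apply: openU => //; apply: openI => //; exact: open_interior.
  - move=> y; rewrite inE => /predU1P[->|/QT/set_mem Ty]; apply/mem_set.
      by right.
    by left.
  - by move=> y [/TO|[]].
  - rewrite /V image_setU closureU => b [/VT//|]; move/closure_subset => h.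
    apply: NW; apply: h => _ [y [/interior_subset Ny _] <-]; exact: Ny.
rewrite compact_ultra => G UG GD.
have /choice[b Gb] (u : @unit_maps R X) : exists r : R,
    (fun x => set_val u x) @ G --> r.
  have [_ ru] := set_valP u.
  have [|r [_ Gr]] := ultra_cvg_compact (f := set_val u) UG
    (@segment_compact R 0%R 1%R); last by exists r.
  by apply: filterS GD => x _; apply: ru; exists x.
have eGb : @cube_eval R X @ G --> (b : {ptws @unit_maps R X -> R}).
  exact/ptws_cvgP.
(* [G] is only known to contain [closure D]; openness of the preimage of [B] then yields a point of
   [D] itself. *)
have clb : closure (@cube_eval R X @` D) b.
  move=> N; rewrite nbhsE => -[B [oB Bb] BN].
  have GB : G (@cube_eval R X @^-1` B) by apply: eGb; exact: open_nbhs_nbhs.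
  have [x [Dx Bx]] := filter_ex (filterI GD GB).
  have oeB : open (@cube_eval R X @^-1` B).
    by apply: open_comp oB => ? _; exact: cube_eval_continuous.
  have [y [Dy By]] := Dx _ (open_nbhs_nbhs (conj oeB Bx)).
  by exists (@cube_eval R X y); split; [exists y|exact: BN].
have [x _ xb] : range (@cube_eval R X) b.
  apply: eW => [|n].
    by apply: closure_subset clb => _ [y _ <-]; exists y.
  have [T DT] := VD n; apply; apply: closure_subset clb => _ [y Dy <-].
  by exists y => //; exact: DT.
have Gx : G --> x by apply: (cube_eval_cvg (R := R)) => //; rewrite xb.
exists x; split=> //.
exact: (closed_cvg (F := G) (u_ := id) _ (@closed_closure _ D) GD _ Gx).
Qed.

(** * Continuous homomorphisms and the inductive choice of points and maps *)

Lemma CHom1 (X K : topologicalGroupType) (f : X -> K) : CHom X K f -> f 1 = 1.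
Proof. by case=> _ fM; apply: (mulgI (f 1)); rewrite -fM !mulg1. Qed.

Lemma CHomV (X K : topologicalGroupType) (f : X -> K) (x : X) :
  CHom X K f -> f x^-1 = (f x)^-1.
Proof.
move=> fH; apply/esym/mulg1_eq; case: (fH) => _ fM.
by rewrite -fM mulgV CHom1.
Qed.

Lemma CHom_cvg1 (X K : topologicalGroupType) (f : X -> K) (N : set K) :
  CHom X K f -> nbhs 1 N -> \forall v \near (1 : X), N (f v).
Proof. by move=> fH N1; case: (fH) => cf _; apply: cf; rewrite (CHom1 fH). Qed.

Definition extend_words (G : groupType) (Q : seq G) (a : G) : seq G :=
  [seq q * e | q <- Q, e <- [:: 1; a; a^-1]].

(** The ordered products of powers of [x 0], ..., [x (n - 1)] with exponents 0, 1 and -1. The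
    exponent -1 serves the later points [(x k)^-1 * x l]; the exponent 0 makes the lists grow with
    [n]. *)
Fixpoint words (G : groupType) (x : nat -> G) (n : nat) : seq G :=
  if n is m.+1 then extend_words (words x m) (x m) else [:: 1].

(* The words found so far lie in the open set [guard], and so must all later
   words. *)
Record search_state (X K : Type) := SearchState {
  level : nat;
  found_words : seq X;
  found_maps : seq (X -> K);
  guard : set X;
  last_point : X;
  last_map : X -> K
}.

Lemma seq_near (T : Type) (F : set_system T) (FF : Filter F) (I : eqType)
    (s : seq I) (P : I -> T -> Prop) :
  (forall i, i \in s -> \near F, P i F) ->
  \near F, forall i, i \in s -> P i F.
Proof.
elim: s => [|i s IH] sP; first by apply: nearW => t i.
have := sP i (mem_head _ _); have : \near F, forall i, i \in s -> P i F.
  by apply: IH => j js; apply: sP; rewrite inE js orbT.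
apply: filterS2 => t Ps Pi j; rewrite inE => /predU1P[->//|]; exact: Ps.
Qed.

Lemma near_words (X : topologicalGroupType) (Q : seq X) (T : set X) :
  open T -> {subset Q <= T} ->
  \forall v \near (1 : X), {subset extend_words Q v <= T}.
Proof.
move=> oT QT.
have : \forall v \near (1 : X), forall q, q \in Q ->
    T q /\ T (q * v) /\ T (q * v^-1).
  apply: seq_near => q /QT/set_mem Tq.
  have nT : nbhs q T by exact: open_nbhs_nbhs.
  have c1 : (fun v : X => q * v) @ (1 : X) --> q.
    rewrite -[in X in _ --> X](mulg1 q); apply: cvgMg; first exact: cvg_cst.
    exact: cvg_id.
  have c2 : (fun v : X => q * v^-1) @ (1 : X) --> q.
    rewrite -[in X in _ --> X](mulg1 q) -[in X in _ --> X]invg1.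
    by apply: cvgMg; [exact: cvg_cst|apply: cvgVg; exact: cvg_id].
  have {}c1 : \forall v \near (1 : X), T (q * v) by exact: c1.
  have {}c2 : \forall v \near (1 : X), T (q * v^-1) by exact: c2.
  by near=> v; split=> //; split; near: v.
apply: filterS => v vT y /allpairsP[[q e] /= [/vT[q1 [q2 q3]] + ->]].
by rewrite !inE => /or3P[] /eqP->; rewrite ?mulg1.
Unshelve. all: by end_near. Qed.

Lemma independent_search (R : realType) (X K : topologicalGroupType)
    (G : set (X -> K)) (N : nat -> set K) (U : set K) :
  completely_regular_space X -> cech_complete R X -> G `<=` CHom X K ->
  (forall n, nbhs 1 (N n)) ->
  ~ (\forall v \near (1 : X), forall f, G f -> U (f v)) ->
  exists (x : nat -> X) (f : nat -> X -> K),
    [/\ forall n, G (f n), forall n, ~ U (f n (x n)),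
        forall k n, (k < n)%N -> N n (f k (x n)) &
        compact (closure [set y | exists n, y \in words x n])].
Proof.
move=> crX ccX GH N1 nU.
have [V [Vsmall Vcompact]] := cech_complete_small crX ccX.
pose valid (s : search_state X K) := [/\ open (guard s),
  {subset found_words s <= guard s} & forall f, f \in found_maps s -> G f].
pose next (s t : search_state X K) := [/\ G (last_map t),
  ~ U (last_map t (last_point t)) &
  forall f, f \in found_maps s -> N (level s) (f (last_point t))] /\
  [/\ level t = (level s).+1,
  found_words t = extend_words (found_words s) (last_point t),
  found_maps t = last_map t :: found_maps s, guard t `<=` guard s &
  V (level t) (guard t)].
have step (s : {s | valid s}) : {t : {t | valid t} | next (sval s) (sval t)}.
  apply: cid; case: s => s [/= oT wT mG].
  have nearN : \forall v \near (1 : X), forall f, f \in found_maps s ->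
      N (level s) (f v).
    by apply: seq_near => f /mG/GH fH; exact: CHom_cvg1.
  (* Both requirements hold near 1, and by [nU] every neighbourhood of 1 has a point at which some
     member of [G] leaves [U]. *)
  have [v [[wv Nv] nUv]] : exists v, ({subset extend_words (found_words s) v
      <= guard s} /\ (forall f, f \in found_maps s -> N (level s) (f v))) /\
      ~ (forall f, G f -> U (f v)).
    apply: contrapT => nex; apply: nU.
    apply: filterS2 (near_words oT wT) nearN => v wv Nv.
    by apply: contrapT => nUv; apply: nex; exists v.
  have [f Gf nUf] : exists2 f, G f & ~ U (f v).
    apply: contrapT => nex; apply: nUv => f Gf.
    by apply: contrapT => nUf; apply: nex; exists f.
  have [T [oT' wT' TT VT]] := Vsmall (level s).+1 _ _ oT wv.
  pose t := SearchState (level s).+1 (extend_words (found_words s) v)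
    (f :: found_maps s) T v f.
  have vt : valid t.
    by split=> //= g; rewrite inE => /predU1P[->//|]; exact: mG.
  by exists (exist _ t vt).
have [T0 [oT0 wT0 _ VT0]] : exists T, [/\ open T, {subset [:: (1 : X)] <= T},
    T `<=` setT & V 0%N T].
  by apply: Vsmall => [|y _]; [exact: openT|exact: in_setT].
have v0 : valid (SearchState 0 [:: 1] [::] T0 1 (fun=> 1)) by [].
have [u [u0 uS]] := dependent_choice step (exist _ _ v0).
(* The last point and map of the initial state are placeholders, hence the shift: [x n] and [f n]
   are found in passing from [s n] to [s n.+1]. *)
pose s n := sval (u n); pose x n := last_point (s n.+1).
pose f n := last_map (s n.+1).
have sw n : found_words (s n) = words x n.
  elim: n => [|n IH]; first by rewrite /s u0.
  by have [_ [_ + _ _ _]] := uS n; rewrite -/(s n.+1) => ->; rewrite -/(s n) IH.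
have sl n : level (s n) = n.
  elim: n => [|n IH]; first by rewrite /s u0.
  by have [_ [+ _ _ _ _]] := uS n; rewrite -/(s n.+1) => ->; rewrite -/(s n) IH.
have sm k n : (k < n)%N -> f k \in found_maps (s n).
  elim: n => // n IH; rewrite ltnS leq_eqVlt.
  have [_ [_ _ + _ _]] := uS n; rewrite -/(s n.+1) => ->.
  by rewrite inE => /predU1P[->|/IH ->]; rewrite ?eqxx ?orbT.
have sg n m : (n <= m)%N -> guard (s m) `<=` guard (s n).
  elim: m => [|m IH]; first by rewrite leqn0 => /eqP->.
  rewrite leq_eqVlt => /predU1P[->//|/IH mn].
  by have [_ [_ _ _ + _]] := uS m; move/subset_trans; apply.
(* Every word lies in every guard: late words because the guards decrease, early ones because the
   exponent 0 keeps them in the later lists. *)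
have wg n m y : y \in words x m -> guard (s n) y.
  move=> ym; have [/ltnW nm|mn] := ltnP n m.
    apply: sg nm _ _; apply/set_mem; have [_ + _] := svalP (u m); apply.
    by rewrite -/(s m) sw.
  apply/set_mem; have [_ + _] := svalP (u n); apply; rewrite -/(s n) sw.
  elim: n mn => [|n IH]; first by rewrite leqn0 => /eqP<-.
  rewrite leq_eqVlt => /predU1P[<-//|/IH yn].
  apply/allpairsP; exists (y, 1); rewrite /= mulg1.
  by split=> //; exact: mem_head.
exists x, f; split=> [n|n|k n kn|].
- by have [[]] := uS n.
- by have [[]] := uS n.
- have [[_ _ +] _] := uS n; rewrite -/(s n) sl; apply; exact: sm.
- apply: Vcompact => n; exists (guard (s n)); first by move=> y [m]; exact: wg.
  case: n => [|n]; first by rewrite /s u0.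
  by have [_ [+ _ _ _ +]] := uS n; rewrite -/(s n) -/(s n.+1) => ->; rewrite sl.
Qed.

(** * Almost constant pairs and independent maps *)

Lemma ultra_eventually : exists p : set_system nat,
  UltraFilter p /\ forall m, p [set n | (m < n)%N].
Proof.
have [p [Up np]] := ultraFilterLemma eventually_filter.
by exists p; split=> // m; apply: np; exists m.+1.
Qed.

(** Let [c m] be the limit of [a n m] in [n] along a free ultrafilter, and [b] the limit of [c]. If
    [c k] and [c l] are close to [b], then [a n k] and [a n l] are close for almost all [n], and all
    later [k j] are picked among these [n]. *)
Lemma almost_constant_pairs (K : topologicalGroupType) (a : nat -> nat -> K)
    (N : nat -> set K) :
  compact [set: K] -> (forall i, nbhs 1 (N i)) ->
  exists k l : nat -> nat,
    [/\ forall i, (k i < l i)%N, forall i, (l i < k i.+1)%N &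
        forall i j, (i < j)%N -> N i ((a (k j) (k i))^-1 * a (k j) (l i))].
Proof.
move=> cK N1; have [p [Up np]] := ultra_eventually.
have ultraK (h : nat -> K) : exists b : K, h @ p --> b.
  have [|b [_ hb]] := ultra_cvg_compact (f := h) Up cK; first exact: filterT.
  by exists b.
have /choice[c ac] m : exists b : K, a^~ m @ p --> b by exact: ultraK.
have [b cb] := ultraK c.
(* A state holds its stage, a set in [p] of indices still admissible for later [k j], and the latest
   pair. *)
pose state := (nat * set nat * (nat * nat))%type.
pose next (s t : state) := [/\ t.1.1 = s.1.1.+1, t.1.2 `<=` s.1.2,
  s.1.2 t.2.1, (s.2.2 < t.2.1 < t.2.2)%N &
  forall n, t.1.2 n -> N s.1.1 ((a n t.2.1)^-1 * a n t.2.2)].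
have step (s : {s : state | p s.1.2}) :
    {t : {t : state | p t.1.2} | next (sval s) (sval t)}.
  apply: cid; case: s => -[[i S] [k l]] /= pS.
  have [W [oW W1 WV WW]] := nbhs1_sym_split (nbhs_interior (N1 i)).
  have pW : p [set m | W (b^-1 * c m)].
    have : (fun m => b^-1 * c m) @ p --> 1.
      by rewrite -(mulVg b); apply: cvgMg => //; exact: cvg_cst.
    by apply; exact: open_nbhs_nbhs.
  have [k' [[Sk' Wk'] lk']] := filter_ex (filterI (filterI pS pW) (np l)).
  have [l' [Wl' kl']] := filter_ex (filterI pW (np k')).
  have pN : p [set n | N i ((a n k')^-1 * a n l')].
    have : (fun n => (a n k')^-1 * a n l') @ p --> (c k')^-1 * c l'.
      by apply: cvgMg => //; exact: cvgVg.
    apply; have := WW _ _ (WV _ Wk') Wl'.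
    by rewrite invgM invgK -mulgA mulVKg.
  pose t : state :=
    (i.+1, S `&` [set n | N i ((a n k')^-1 * a n l')], (k', l')).
  have pt : p t.1.2 by exact: filterI.
  exists (exist _ t pt); split=> /=; [by []|by move=> n []|by []| |].
    exact/andP.
  by move=> n [].
pose s0 : state := (0%N, setT, (0%N, 0%N)).
have p0 : p s0.1.2 by exact: filterT.
have [u [u0 uS]] := dependent_choice step (exist _ _ p0).
pose s n := sval (u n).
have sl n : (s n).1.1 = n.
  elim: n => [|n IH]; first by rewrite /s u0.
  by have [+ _ _ _ _] := uS n; rewrite -/(s n) -/(s n.+1) IH.
have sS n m : (n <= m)%N -> (s m).1.2 `<=` (s n).1.2.
  elim: m => [|m IH]; first by rewrite leqn0 => /eqP->.
  rewrite leq_eqVlt => /predU1P[->//|/IH mn].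
  by have [_ + _ _ _] := uS m; move/subset_trans; apply.
exists (fun i => (s i.+1).2.1), (fun i => (s i.+1).2.2); split=> [i|i|i j ij].
- by have [_ _ _ /andP[]] := uS i.
- by have [_ _ _ /andP[]] := uS i.+1.
- have [_ _ _ _] := uS i; rewrite -/(s i) -/(s i.+1) sl; apply.
  by apply: sS ij _ _; have [] := uS j.
Qed.

(** The first factor and, by induction, the product of the others both lie in [W m.+1]. *)
Lemma prod_chain (K : topologicalGroupType) (W : nat -> set K) (b : nat -> K)
    (m n : nat) :
  (forall i, W i 1) ->
  (forall i x y, W i.+1 x -> W i.+1 y -> W i (x * y)) ->
  (forall i, (m <= i < n)%N -> W i.+1 (b i)) ->
  W m (\prod_(m <= i < n) b i).
Proof.
move=> W1 WW; have [nm _|/ltnW mn] := leqP n m; first by rewrite big_geq.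
elim: (n - m)%N {-2}m (subnKC mn) => [|d IH] k.
  by rewrite addn0 => <- _; rewrite big_geq.
move=> kn Wb; have ltkn : (k < n)%N by rewrite -kn -addSnnS leq_addr.
rewrite big_ltn //; apply: WW; first by apply: Wb; rewrite leqnn.
apply: IH => [|i /andP[ki lin]]; first by rewrite addSnnS.
by apply: Wb; rewrite lin ltnW.
Qed.

Lemma words_last (G : groupType) (x : nat -> G) n (y : G) : y \in words x n ->
  [/\ y \in words x n.+1, y * x n \in words x n.+1 &
      y * (x n)^-1 \in words x n.+1].
Proof.
move=> yn; split; apply/allpairsP.
- by exists (y, 1); rewrite !inE eqxx mulg1.
- by exists (y, x n); rewrite !inE eqxx orbT.
- by exists (y, (x n)^-1); rewrite !inE eqxx !orbT.
Qed.

Lemma words_mono (G : groupType) (x : nat -> G) n m : (n <= m)%N ->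
  {subset words x n <= words x m}.
Proof.
elim: m => [|m IH]; first by rewrite leqn0 => /eqP->.
by rewrite leq_eqVlt => /predU1P[->//|/IH nm] y /nm/words_last[].
Qed.

(** The indices of [W] record precision. For [i != n], [g n (z i)] lies in [W (i + 7)], so products
    avoiding [z n] are sent into [W 6]. Two of these multiply into [W 5] when [r n] is false; when
    it is true, they keep the value out of [W 3], as [g n (z n)] is outside [W 1]. Passing to the
    limit weakens only [W 5], to [W 4]. *)
Lemma independent_maps (X K : topologicalGroupType) (G : set (X -> K))
    (W : nat -> set K) (x : nat -> X) (f : nat -> X -> K) :
  compact [set: K] -> G `<=` CHom X K ->
  (forall i, open (W i)) -> (forall i, W i 1) ->
  (forall i u, W i u -> W i u^-1) ->
  (forall i u v, W i.+1 u -> W i.+1 v -> W i (u * v)) ->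
  (forall n, G (f n)) -> (forall n, ~ W 0 (f n (x n))) ->
  (forall k n, (k < n)%N -> W (n + 8)%N (f k (x n))) ->
  compact (closure [set y | exists n, y \in words x n]) ->
  exists (g : nat -> X -> K) (y : (nat -> bool) -> X), [/\ forall n, G (g n),
    forall r, closure [set y | exists n, y \in words x n] (y r) &
    forall r n, if r n then ~ W 3 (g n (y r)) else W 4 (g n (y r))].
Proof.
move=> cK GH oW W1 WV WM Gf fx_far fx_near cY.
have Wmono i j : (i <= j)%N -> W j `<=` W i.
  elim: j => [|j IH]; first by rewrite leqn0 => /eqP->.
  rewrite leq_eqVlt => /predU1P[->//|/IH ij] u Wu; apply: ij.
  by rewrite -[u]mulg1; exact: WM.
have [k [l [kl lk almost_cst]]] := almost_constant_pairs
  (fun n m => f n (x m)) cK (N := fun i => W (i + 8)%N)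
  (fun i => open_nbhs_nbhs (conj (oW _) (W1 _))).
have k_incr i j : (i < j)%N -> (k i < k j)%N.
  elim: j => // j IH; rewrite ltnS leq_eqVlt => /predU1P[->|/IH ij].
    exact: ltn_trans (kl j) (lk j).
  exact: ltn_trans ij (ltn_trans (kl j) (lk j)).
have le_k i : (i <= k i)%N.
  by elim: i => // i IH; apply: leq_ltn_trans IH _; exact: k_incr.
pose z i := (x (k i))^-1 * x (l i); pose g i := f (k i).
have gH i : CHom X K (g i) by apply: GH; exact: Gf.
have gM i : {morph g i : u v / u * v} by have [_] := gH i; exact.
have gz i j : g j (z i) = (g j (x (k i)))^-1 * g j (x (l i)).
  by rewrite gM (CHomV _ (gH j)).
(* For [i < j] this is almost constancy; for [j < i] the two factors are small separately, and
   multiplying them costs one index. *)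
have gz_near i j : i != j -> W (i + 7)%N (g j (z i)).
  rewrite neq_ltn gz => /orP[ij|ji].
    by apply: (Wmono _ (i + 8)%N); [rewrite leq_add2l|exact: almost_cst].
  apply: WM; rewrite -addnS.
    apply: WV; apply: (Wmono _ (k i + 8)%N); first by rewrite leq_add2r.
    by apply: fx_near; exact: k_incr.
  apply: (Wmono _ (l i + 8)%N).
    by rewrite leq_add2r (leq_trans (le_k i)) // ltnW.
  by apply: fx_near; apply: ltn_trans (kl i); exact: k_incr.
have gz_far i : ~ W 1%N (g i (z i)).
  move=> W1z; apply: (fx_far (k i)).
  have -> : f (k i) (x (k i)) = g i (x (l i)) * (g i (z i))^-1.
    by rewrite gz invgM invgK mulVKg.
  apply: WM; last exact: WV.
  by apply: (Wmono _ (l i + 8)%N); [rewrite addnS|exact: fx_near].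
pose e (r : nat -> bool) i := if r i then z i else 1.
pose w r m := \prod_(0 <= i < m) e r i.
(* As [k i < l i < k i.+1], the [z i] use disjoint increasing blocks of the [x n], so their products
   are again words. *)
have w_words r m : w r m \in words x (k m).
  elim: m => [|m IH].
    by rewrite /w big_geq //; apply: (words_mono (leq0n _)); rewrite inE.
  rewrite /w big_nat_recr //=; rewrite -/(w r m) /e.
  case: (r m); last first.
    by rewrite mulg1; apply: words_mono IH; exact/ltnW/k_incr.
  have [_ _ /(words_mono (kl m))/words_last[_ + _]] := words_last IH.
  by rewrite mulgA; apply: words_mono.
have g_prod n r a b : g n (\prod_(a <= i < b) e r i) =
    \prod_(a <= i < b) g n (e r i).
  exact: (big_morph (g n) (gM n) (CHom1 (gH n))).
have g_tail n r a b : (forall i, (a <= i < b)%N -> i != n) ->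
    W 6 (g n (\prod_(a <= i < b) e r i)).
  move=> an; rewrite g_prod; apply: (Wmono _ (a + 6)%N).
    by rewrite leq_addl.
  have := @prod_chain K (fun i => W (i + 6)%N) (fun i => g n (e r i)) a b.
  apply=> // [i u v|i /an ni]; first by rewrite addSn; exact: WM.
  rewrite addSn -addnS /e; case: (r i); first exact: gz_near.
  by rewrite (CHom1 (gH n)).
have gw r n m : (n < m)%N ->
    if r n then ~ W 3 (g n (w r m)) else W 5 (g n (w r m)).
  move=> nm; have -> : w r m = w r n * (e r n * \prod_(n.+1 <= i < m) e r i).
    by rewrite /w -big_ltn // -big_cat_nat //= ltnW.
  rewrite gM (gM _ (e r n)); set A := g n (w r n).
  set C := g n (\prod_(_ <= i < _) _).
  have WA : W 6 A by apply: g_tail => i /andP[_ /ltn_eqF/negbT].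
  have WC : W 6 C by apply: g_tail => i /andP[/gtn_eqF/negbT].
  rewrite /e; case: (r n); last first.
    by rewrite (CHom1 (gH n)) mul1g; exact: WM.
  move=> W3; apply: (gz_far n).
  (* Cancelling [A] and then [C] loses one index each time, from [W 3] down to [W 1]. *)
  have -> : g n (z n) = (A^-1 * (A * (g n (z n) * C))) * C^-1.
    by rewrite mulKg mulgK.
  apply: (WM); last by apply: (Wmono _ 6%N) => //; exact: WV.
  by apply: WM => //; apply: (Wmono _ 6%N) => //; exact: WV.
have [p [Up np]] := ultra_eventually.
have /choice[y Yy] r : exists y : X,
    closure [set y | exists n, y \in words x n] y /\ w r @ p --> y.
  apply: ultra_cvg_compact cY _; apply: filterE => m.
  by apply: subset_closure; exists (k m).
exists g, y; split=> [n|r|r n]; [exact: Gf|exact: (Yy r).1|].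
have gy : (fun m => g n (w r m)) @ p --> g n (y r).
  by apply: cvg_comp (Yy r).2 _; case: (gH n) => + _; exact.
have pn : p [set m | if r n then ~ W 3 (g n (w r m)) else W 5 (g n (w r m))].
  by apply: filterS (np n) => m; exact: gw.
case: (r n) pn => pn.
  have : (~` W 3) (g n (y r)); last by [].
  exact: closed_cvg (open_closedC (oW 3)) pn _ gy.
apply: (closure_sub_mul (oW 5) (W1 5) (@WV 5) (@WM 4)).
apply: (closed_cvg _ (@closed_closure _ _) _ _ gy).
by apply: filterS pn => m W5; exact: subset_closure.
Qed.

(** * Independent families, cardinality and tightness *)

Lemma ultra_fip (J : eqType) (T : Type) (A : J -> set T) :
  (forall s : seq J, exists t, forall j, j \in s -> A j t) ->
  exists p : set_system T, UltraFilter p /\ forall j, p (A j).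
Proof.
move=> fipA.
pose B (s : seq J) := [set t | forall j, j \in s -> A j t].
have FB : Filter (filter_from setT B).
  apply: filter_from_filter; first by exists [::].
  move=> s1 s2 _ _; exists (s1 ++ s2) => // t Bt.
  by split=> j js; apply: Bt; rewrite mem_cat js ?orbT.
have PB : ProperFilter (filter_from setT B).
  by apply: filter_from_proper => s _; have [t st] := fipA s; exists t.
have [p [Up Bp]] := ultraFilterLemma PB.
exists p; split=> // j; apply: Bp; exists [:: j] => // t; apply.
by rewrite inE.
Qed.

(** Diagonal argument: for injective [phi], the predicate [t0] would hold at [phi t0] exactly when
    it fails there. *)
Lemma cantor_no_injection (T : Type) (phi : (T -> bool) -> T) : ~ injective phi.
Proof.
move=> phi_inj; pose t0 r := `[< forall t, phi t = r -> ~~ t r >].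
have [t0r|] := boolP (t0 (phi t0)).
  by have /asboolP/(_ t0 erefl) := t0r; rewrite t0r.
move=> nt0; have /asboolP := nt0; apply: contrapT => /= nf.
apply: nf => nf; apply: nf => t /phi_inj ->; exact: nt0.
Qed.

(** Countable sets are Lebesgue null, but the unit interval has measure 1. *)
Lemma uncountable_reals (R : realType) : ~ countable [set: R].
Proof.
move=> cR; have c01 : countable `[(0 : R)%R, 1%R].
  exact: sub_countable (subset_card_le (@subsetT _ _)) cR.
have := countable_lebesgue_measure0 c01.
rewrite lebesgue_measure_itv /= lte_fin ltr01 oppr0 adde0 => -[] /eqP.
by rewrite oner_eq0.
Qed.

(** A new point other than [x] is excluded by moving the endpoint on its side to a rational between
    it and [x]. *)
Lemma rat_interval_avoiding (R : realType) (s : seq R) (x : R) :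
  exists pq : rat * rat, (ratr pq.1 < x < ratr pq.2)%R /\
    forall y, y \in s -> y != x -> ~~ (ratr pq.1 < y < ratr pq.2)%R.
Proof.
elim: s => [|y s [[p q] /= [/andP[px xq] IH]]].
  have [|p] := @rat_in_itvoo R (x - 1)%R x; first by rewrite ltrBlDr ltrDl.
  move=> /[!in_itv]/= /andP[_ px].
  have [|q] := @rat_in_itvoo R x (x + 1)%R; first by rewrite ltrDl.
  by move=> /[!in_itv]/= /andP[xq _]; exists (p, q); rewrite /= px xq.
have [yx|xy|yx] := ltgtP y x.
- have [|p'] := @rat_in_itvoo R (Num.max (ratr p) y) x.
    by rewrite gt_max px yx.
  move=> /[!in_itv]/= /andP[]; rewrite gt_max => /andP[pp' yp'] p'x.
  exists (p', q); split=> /=; first by rewrite p'x xq.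
  move=> u; rewrite inE => /predU1P[-> _|us ux]; first by rewrite (lt_gtF yp').
  by apply: contra (IH u us ux) => /andP[p'u ->]; rewrite (lt_trans pp').
- have [|q'] := @rat_in_itvoo R x (Num.min (ratr q) y).
    by rewrite lt_min xq xy.
  move=> /[!in_itv]/= /andP[xq']; rewrite lt_min => /andP[q'q q'y].
  exists (p, q'); split=> /=; first by rewrite px xq'.
  move=> u; rewrite inE => /predU1P[-> _|us ux].
    by rewrite (lt_gtF q'y) andbF.
  by apply: contra (IH u us ux) => /andP[-> uq']; rewrite (lt_trans uq').
- exists (p, q); split=> /=; first by rewrite px xq.
  by move=> u; rewrite inE => /predU1P[->|us ux]; [rewrite yx eqxx|exact: IH].
Qed.

(* A natural number codes a finite union of rational intervals, and [I x] is the
   set of those codes whose union contains [x]. *)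
Lemma independent_family (R : realType) : exists I : R -> nat -> bool,
  forall (s : seq R) (t : R -> bool), exists n,
    forall x, x \in s -> I x n = t x.
Proof.
pose inside (x : R) (pq : rat * rat) := (ratr pq.1 < x < ratr pq.2)%R.
exists (fun x n => if unpickle n is Some l then has (inside x) l else false).
move=> s t; have /choice[pq pqP] := rat_interval_avoiding s.
exists (pickle [seq pq x | x <- s & t x]) => x xs; rewrite pickleK.
apply/hasP/idP => [[_ /mapP[x' + ->] xx']|tx].
  rewrite mem_filter => /andP[tx' _]; have [->//|ne] := eqVneq x x'.
  by have := (pqP x').2 x xs ne; rewrite -/(inside x (pq x')) xx'.
exists (pq x); last exact: (pqP x).1.
by apply: map_f; rewrite mem_filter tx.
Qed.

(** The cube enters through a section: [z t] is a limit of the [h n] whose value at [v (I x)] lies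
    in [C] or [D] according to [t x]. As [C] and [D] are disjoint, [z] is injective, and Cantor's
    theorem excludes an injection of [Z] into [R]. *)
Lemma independent_closure (R : realType) (Y : choiceType) (K : topologicalType)
    (h : nat -> Y -> K) (v : (nat -> bool) -> Y) (C D : set K) :
  compact [set: K] -> closed C -> closed D -> C `&` D = set0 ->
  (forall r n, if r n then C (h n (v r)) else D (h n (v r))) ->
  let Z := closure (range h : set {ptws Y -> K}) in
  ~ countably_tight Z /\ ~ (Z #<= [set: R]).
Proof.
move=> cK cC cD CD0 hCD Z.
have limK (T : Type) (p : set_system T) (Up : UltraFilter p)
    (f : T -> {ptws Y -> K}) : exists z : {ptws Y -> K},
    f @ p --> z /\ forall u, (fun t => f t u) @ p --> z u.
  have /choice[z fz] u : exists k : K, (fun t => f t u) @ p --> k.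
    by have [|k [_]] := ultra_cvg_compact (f := fun t => f t u) Up cK;
      [exact: filterT|exists k].
  by exists z; split=> //; exact/ptws_cvgP.
have [I indI] := independent_family R.
have /choice[z zP] (t : R -> bool) : exists z, Z z /\
    forall x, if t x then C (z (v (I x))) else D (z (v (I x))).
  have [|p [Up pI]] := @ultra_fip R nat (fun x => [set n | I x n = t x]).
    by move=> s; exact: indI.
  have [z [hz hzu]] := limK _ p Up h; exists z; split=> [|x].
    apply: (closed_cvg _ (@closed_closure _ _) _ _ hz).
    by apply: filterE => n; apply: subset_closure; exists n.
  have {}pI : p [set n | if t x then C (h n (v (I x))) else D (h n (v (I x)))].
    by apply: filterS (pI x) => n /= <-; exact: hCD.
  by case: (t x) pI => pI; [exact: closed_cvg cC pI _ (hzu _)|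
    exact: closed_cvg cD pI _ (hzu _)].
have CD k : C k -> D k -> False by move=> Ck Dk; rewrite -[False]/(set0 k) -CD0.
pose zZ t : Z := SigSub (mem_set (zP t).1).
split; last first.
  move=> /card_leP[f].
  apply: (@cantor_no_injection R (fun t => set_val (f (zZ t)))).
  move=> t1 t2 /val_inj/(inj) zz; have {}zz : z t1 = z t2.
    have : zZ t1 = zZ t2 by apply: zz; rewrite inE.
    by move/(congr1 set_val).
  apply/funext => x; have := (zP t1).2 x; have := (zP t2).2 x; rewrite zz.
  by case: (t1 x) (t2 x) => [] [] // ? ?; exfalso; apply: CD; eassumption.
move=> tight.
(* Indicators of finite sets give the finite intersection property. The limit [z1] of [z] along [q]
   stands for the constant point 1. *)
have [|q [Uq qx]] := @ultra_fip R (R -> bool)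
    (fun x => [set t | countable [set x | t x] /\ t x]).
  move=> s; exists (fun x => x \in s) => x xs; split=> //.
  exact: finite_set_countable (finite_seq s).
have [z1 [zz1 zz1u]] := limK _ q Uq z.
have Zz1 : Z z1.
  apply: (closed_cvg _ (@closed_closure _ _) _ _ zz1).
  by apply: filterE => t; exact: (zP t).1.
have Cz1 x : C (z1 (v (I x))).
  apply: closed_cvg cC _ _ (zz1u _); apply: filterS (qx x) => t [_ tx].
  by have := (zP t).2 x; rewrite tx.
have [|B [BA cB clB]] := tight
    [set zZ t | t in [set t : R -> bool | countable [set x | t x]]]
    (SigSub (mem_set Zz1)).
  move=> N /nbhs_set_typeP[V Vz1 VN].
  have qV : q (z @^-1` V) by exact: zz1.
  (* The real 0 is arbitrary: only the countable support of [t] is wanted. *)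
  have [t [Vt [ct _]]] := filter_ex (filterI qV (qx 0%R)).
  by exists (zZ t); split; [exists t|exact: VN].
have /choice[tB tBP] (b : Z) : exists t : R -> bool,
    B b -> countable [set x | t x] /\ zZ t = b.
  have [/BA[t ct tb]|nB] := pselect (B b); first by exists t.
  by exists (fun=> false) => /nB.
(* Countably many countable supports miss a real [x]; at [v (I x)] all members of [B] lie in [D],
   while [z1] lies in [C]. *)
have [x xS] : exists x, ~ (\bigcup_(b in B) [set x | tB b x]) x.
  apply: contrapT => nx; apply: (@uncountable_reals R).
  have -> : [set: R] = \bigcup_(b in B) [set x | tB b x].
    apply/seteqP; split=> // x _; apply: contrapT => nBx.
    by apply: nx; exists x.
  by apply: bigcup_countable => // b /tBP[].
apply: (CD _ (Cz1 x)); apply: cD => N z1N.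
have [|b [Bb bN]] := clB (set_val @^-1` [set f | N (f (v (I x)))]).
  apply/nbhs_set_typeP.
  exists [set f : {ptws Y -> K} | N (f (v (I x)))]; last by [].
  by apply: ptws_eval_continuous; rewrite set_valE.
exists (set_val b (v (I x))); split=> //.
have [_ <-] := tBP b Bb; have := (zP (tB b)).2 x.
by case: ifPn => // tBx; exfalso; apply: xS; exists b.
Qed.

(** * From neighbourhoods of 1 to equicontinuity *)

(** The uniformity is not assumed to come from translations. Continuity of multiplication at
    [(k, 1)] gives closeness near each [k], and compactness makes it uniform in [k]. *)
Lemma compact_entourage_mul (K : puniformGroupType) (E : set (K * K)) :
  compact [set: K] -> entourage E ->
  \forall u \near (1 : K), forall k, E (k, k * u).
Proof.
move=> cK entE.
have cover := (compact_near_coveringP [set: K]).1 cK K (nbhs (1 : K))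
  (fun u k => E (k, k * u)) (nbhs_filter _).
suff /cover : forall k, [set: K] k ->
    \forall k' \near k & u \near (1 : K), E (k', k' * u).
  by apply: filterS => u uE k; exact: uE.
move=> k _.
have nE : nbhs k (xsection (split_ent E) k).
  by apply: nbhs_entourage; exact: entourage_split_ent.
have nE' : nbhs k (xsection (split_ent E)^-1%relation k).
  by apply: nbhs_entourage; apply: entourage_inv; exact: entourage_split_ent.
have := @mulg_continuous K (k, 1) (xsection (split_ent E) k).
rewrite /= mulg1 => /(_ nE)[[A B] /= [kA B1] AB].
exists (A `&` xsection (split_ent E)^-1%relation k, B) => /=.
  by split=> //; exact: filterI.
move=> [k' u] /= [[Ak' /xsectionP k'k] Bu].
apply: (entourage_split k) => //.
by apply/xsectionP; exact: (AB (k', u)).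
Qed.

Lemma separable_closure (X : topologicalType) (A : set X) :
  countable A -> separable_space (closure A).
Proof.
move=> cA; exists (set_val @^-1` A : set (closure A)).
  apply: sub_countable cA; apply: card_ge_preimage => a b _ _.
  exact: val_inj.
move=> U [a Ua] [V oV VU]; move: Ua; rewrite -VU => Va.
have [b [Ab Vb]] := set_valP a _ (open_nbhs_nbhs (conj oV Va)).
by exists (SigSub (mem_set (subset_closure Ab))).
Qed.

Lemma equicontinuous_at1 (R : realType) (X : topologicalGroupType)
    (K : puniformGroupType) (G : set (X -> K)) (U : set K) :
  completely_regular_space X -> cech_complete R X -> compact [set: K] ->
  G `<=` CHom X K ->
  (forall (L : set (X -> K)) (Y : set X),
     L `<=` G -> countable L -> compact Y -> separable_space Y ->
     countably_tight (ptws_closure Y L) \/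
     ptws_closure Y L #<= [set: R]) ->
  nbhs 1 U -> \forall v \near (1 : X), forall f, G f -> U (f v).
Proof.
move=> crX ccX cK GH small U1; apply: contrapT => nU.
have [W [W0U oW W1 WV WM]] := nbhs1_sym_chain U1.
have nW : ~ (\forall v \near (1 : X), forall f, G f -> W 0 (f v)).
  move=> nW; apply: nU; apply: filterS nW => v Wv f Gf.
  by apply: W0U; exact: Wv.
have [x [f [Gf f_far f_near cY]]] := independent_search
  (N := fun n => W (n + 8)%N) crX ccX GH
  (fun n => open_nbhs_nbhs (conj (oW _) (W1 _))) nW.
have [g [y [Gg Yy gy]]] :=
  independent_maps cK GH oW W1 WV WM Gf f_far f_near cY.
set Y := closure _ in cY Yy.
pose v r : Y := SigSub (mem_set (Yy r)).
have W43 : closure (W 4) `<=` W 3.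
  exact: (closure_sub_mul (oW 4) (W1 4) (@WV 4) (@WM 3)).
(* Far values lie in the complement of [W 3] and near ones in the closure of [W 4]; these closed
   sets are disjoint by [W43]. *)
have [| |] := @independent_closure R Y K (fun n => sigL Y (g n)) v
    (~` W 3) (closure (W 4)) cK (open_closedC (oW 3)) (@closed_closure _ _).
- by apply/seteqP; split=> // k [W3 /W43].
- by move=> r n; have := gy r n; case: (r n) => // /subset_closure.
have -> : closure (range (fun n => sigL Y (g n)) : set {ptws Y -> K}) =
    ptws_closure Y (range g).
  by rewrite /ptws_closure image_comp.
move=> ntight ncard; have [] := small (range g) Y; last first.
- exact: ncard.
- exact: ntight.
- apply: separable_closure.
  have -> : [set y | exists n, y \in words x n] =
      \bigcup_n [set` words x n].
    by apply/seteqP; split=> u [n]; [exists n|move=> _ ?; exists n].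
  by apply: bigcup_countable => // n _; exact/finite_set_countable/finite_seq.
- exact: cY.
- exact: sub_countable (card_image_le _ _) _.
- by move=> _ [n _ <-]; exact: Gg.
Qed.

Theorem theorem3 (R : realType) (X : topologicalGroupType)
    (K : puniformGroupType) (G : set (X -> K)) :
  infinite_set [set: X] -> completely_regular_space X -> hausdorff_space X ->
  infinite_set [set: K] -> completely_regular_space K -> hausdorff_space K ->
  cech_complete R X ->
  compact [set: K] ->
  G `<=` CHom X K ->
  infinite_set G ->
  (forall (L : set (X -> K)) (Y : set X),
     L `<=` G -> countable L -> compact Y -> separable_space Y ->
     countably_tight (ptws_closure Y L) \/
     ptws_closure Y L #<= [set: R]) ->
  equicontinuous G id.
Proof.
move=> _ crX _ _ _ _ ccX cK GH _ small x E entE.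
have near1 :=
  equicontinuous_at1 crX ccX cK GH small (compact_entourage_mul cK entE).
(* As [f y = f x * f (x^-1 * y)], translation by [x^-1] reduces the claim at [x] to smallness at 1,
   uniformly in [f]. *)
have cx : (fun y => x^-1 * y) @ x --> (1 : X).
  by rewrite -(mulVg x); apply: cvgMg; [exact: cvg_cst|exact: cvg_id].
have near_x : \forall y \near x, forall f, G f ->
    forall k, E (k, k * f (x^-1 * y)) by exact: cx near1.
apply: filterS near_x => y Ey f Gf; have [_ fM] := GH f Gf.
by have := Ey f Gf (f x); rewrite -fM mulVKg.
Qed.
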